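(* There exist a simple group $G$ generated by two elements and a unimodular word $u\in G*\langle x\rangle_\infty$ such that the mapping $G\to G$, $g\mapsto u(g)$, is surjective but not injective.
   Context: Here $\langle x\rangle_\infty$ is the infinite cyclic group generated by a letter $x$, and $*$ denotes the free product. A word $u=g_1x^{n_1}\cdots g_kx^{n_k}\in G*\langle x\rangle_\infty$ (with $g_i\in G$, $n_i\in\mathbb{Z}$) is called unimodular if $\sum n_i=\pm1$. For $g\in G$, $u(g)\in G$ denotes the result of substituting $g$ for $x$ in $u$, i.e. the image of $u$ under the homomorphism $G*\langle x\rangle_\infty\to G$ that is the identity on $G$ and sends $x$ to $g$. *)

(* Defs.v *)
(* MathComp; [groupType] is the library's structure of arbitrary, possibly
   infinite, groups. *)
From HB Require Import structures.
From mathcomp Require Import all_boot all_order all_algebra.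
From mathcomp Require Import boolp classical_sets.

Set Implicit Arguments.
Unset Strict Implicit.
Unset Printing Implicit Defensive.

Import GRing.Theory.
Local Open Scope group_scope.
Local Open Scope classical_set_scope.
Local Open Scope quotient_scope.

Section Subgroups.
Variable G : groupType.

Definition is_subgroup (H : set G) : Prop :=
  [/\ H 1, forall x y, H x -> H y -> H (x * y) & forall x, H x -> H x^-1].

Definition is_normal_subgroup (N : set G) : Prop :=
  is_subgroup N /\ forall x y, N x -> N (x ^ y).

Definition generated_by (A : set G) : set G := smallest is_subgroup A.

Definition two_generated : Prop :=
  exists a b : G, generated_by [set a; b] = setT.

Definition simple_group : Prop :=
  (exists x : G, x <> 1) /\
  forall N : set G, is_normal_subgroup N -> N = [set 1] \/ N = setT.

End Subgroups.

(* The free product [freeprod G H]: words in letters from the disjoint union of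
   G and H, modulo the congruence generated by the multiplication tables. *)
Section FreeProduct.
Variables G H : groupType.

Inductive word_eq : seq (G + H) -> seq (G + H) -> Prop :=
| word_eq_refl u : word_eq u u
| word_eq_sym u v : word_eq u v -> word_eq v u
| word_eq_trans u v w : word_eq u v -> word_eq v w -> word_eq u w
| word_eq_cat u u' v v' :
    word_eq u u' -> word_eq v v' -> word_eq (u ++ v) (u' ++ v')
| word_eq_1l : word_eq [:: inl 1] [::]
| word_eq_1r : word_eq [:: inr 1] [::]
| word_eq_Ml a b : word_eq [:: inl a; inl b] [:: inl (a * b)]
| word_eq_Mr a b : word_eq [:: inr a; inr b] [:: inr (a * b)].

Definition word_eqb : rel (seq (G + H)) := fun u v => `[< word_eq u v >].

Lemma word_eqb_refl : reflexive word_eqb.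
Proof. by move=> u; apply/asboolP; exact: word_eq_refl. Qed.
Lemma word_eqb_sym : symmetric word_eqb.
Proof. by move=> u v; apply/asboolP/asboolP; exact: word_eq_sym. Qed.
Lemma word_eqb_trans : transitive word_eqb.
Proof.
move=> v u w /asboolP uv /asboolP vw; apply/asboolP; exact: word_eq_trans vw.
Qed.

Canonical word_equiv :=
  EquivRel word_eqb word_eqb_refl word_eqb_sym word_eqb_trans.

Definition freeprod := {eq_quot word_eqb}.
HB.instance Definition _ := Choice.on freeprod.
HB.instance Definition _ := Quotient.on freeprod.

Implicit Types u v w : freeprod.

Lemma fp_piP s t : reflect (\pi_freeprod s = \pi_freeprod t) `[< word_eq s t >].
Proof. exact: (@eqmodP _ word_equiv). Qed.

Lemma fp_pi s t : word_eq s t -> \pi_freeprod s = \pi_freeprod t.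
Proof. by move=> st; apply/fp_piP/asboolP. Qed.

Lemma fp_repr s : word_eq (repr (\pi_freeprod s)) s.
Proof. by apply/asboolP/fp_piP; rewrite reprK. Qed.

Lemma fp_surj u : exists s, u = \pi_freeprod s.
Proof. by exists (repr u); rewrite reprK. Qed.

Definition inv_letter (l : G + H) : G + H :=
  match l with inl a => inl a^-1 | inr b => inr b^-1 end.

Definition inv_word (s : seq (G + H)) := rev (map inv_letter s).

Lemma inv_word_eq s t : word_eq s t -> word_eq (inv_word s) (inv_word t).
Proof.
rewrite /inv_word; elim=> {s t}.
- by move=> s; apply: word_eq_refl.
- by move=> s t _; apply: word_eq_sym.
- by move=> s t r _ st _; apply: word_eq_trans.
- by move=> s s' t t' _ ss _ tt; rewrite !map_cat !rev_cat; apply: word_eq_cat.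
- by rewrite /= /rev /= invg1; apply: word_eq_1l.
- by rewrite /= /rev /= invg1; apply: word_eq_1r.
- by move=> a b; rewrite /= /rev /= invgM; apply: word_eq_Ml.
- by move=> a b; rewrite /= /rev /= invgM; apply: word_eq_Mr.
Qed.

Lemma word_eq_invl s : word_eq (inv_word s ++ s) [::].
Proof.
elim: s => [|l s IHs]; first exact: word_eq_refl.
rewrite /inv_word /= rev_cons -cats1 -catA /=.
apply: (word_eq_trans (v := inv_word s ++ s)) => //.
apply: word_eq_cat; first exact: word_eq_refl.
rewrite -[_ :: _ :: s]/([:: inv_letter l; l] ++ s) -[X in word_eq _ X]cat0s.
apply: word_eq_cat; last exact: word_eq_refl.
case: l => a /=.
  by apply: word_eq_trans (word_eq_Ml _ _) _; rewrite mulVg; apply: word_eq_1l.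
by apply: word_eq_trans (word_eq_Mr _ _) _; rewrite mulVg; apply: word_eq_1r.
Qed.

Lemma inv_wordK : involutive inv_word.
Proof.
move=> s; rewrite /inv_word map_rev revK -map_comp map_id_in //.
by case=> a _ /=; rewrite invgK.
Qed.

Definition fp_one : freeprod := \pi_freeprod [::].
Definition fp_mul u v : freeprod := \pi_freeprod (repr u ++ repr v).
Definition fp_inv u : freeprod := \pi_freeprod (inv_word (repr u)).

Lemma fp_mul_pi s t :
  fp_mul (\pi_freeprod s) (\pi_freeprod t) = \pi_freeprod (s ++ t).
Proof. by apply: fp_pi; apply: word_eq_cat; exact: fp_repr. Qed.

Lemma fp_inv_pi s : fp_inv (\pi_freeprod s) = \pi_freeprod (inv_word s).
Proof. by apply: fp_pi; apply: inv_word_eq; exact: fp_repr. Qed.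

Lemma fp_mulA : associative fp_mul.
Proof.
move=> u v w; have [s ->] := fp_surj u; have [t ->] := fp_surj v;
  have [r ->] := fp_surj w.
by rewrite !fp_mul_pi catA.
Qed.
Lemma fp_mul1 : left_id fp_one fp_mul.
Proof. by move=> u; have [s ->] := fp_surj u; rewrite fp_mul_pi. Qed.
Lemma fp_mulr1 : right_id fp_one fp_mul.
Proof. by move=> u; have [s ->] := fp_surj u; rewrite fp_mul_pi cats0. Qed.
Lemma fp_mulV : left_inverse fp_one fp_inv fp_mul.
Proof.
move=> u; have [s ->] := fp_surj u; rewrite fp_inv_pi fp_mul_pi; apply: fp_pi;
  exact: word_eq_invl.
Qed.
Lemma fp_mulrV : right_inverse fp_one fp_inv fp_mul.
Proof.
move=> u; have [s ->] := fp_surj u; rewrite fp_inv_pi fp_mul_pi; apply: fp_pi.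
by rewrite -{1}[s]inv_wordK; exact: word_eq_invl.
Qed.

HB.instance Definition _ :=
  isGroup.Build freeprod fp_mulA fp_mul1 fp_mulr1 fp_mulV fp_mulrV.

Lemma fp_piM s t :
  \pi_freeprod s * \pi_freeprod t = \pi_freeprod (s ++ t) :> freeprod.
Proof. exact: fp_mul_pi. Qed.

Definition fp_inl (a : G) : freeprod := \pi_freeprod [:: inl a].
Definition fp_inr (b : H) : freeprod := \pi_freeprod [:: inr b].

Lemma fp_inlM : {morph fp_inl : a b / a * b}.
Proof.
move=> a b; rewrite fp_piM; apply: fp_pi.
by apply: word_eq_sym; apply: word_eq_Ml.
Qed.
Lemma fp_inl1 : fp_inl 1 = 1.
Proof. by apply: fp_pi; exact: word_eq_1l. Qed.
Lemma fp_inrM : {morph fp_inr : a b / a * b}.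
Proof.
move=> a b; rewrite fp_piM; apply: fp_pi.
by apply: word_eq_sym; apply: word_eq_Mr.
Qed.
Lemma fp_inr1 : fp_inr 1 = 1.
Proof. by apply: fp_pi; exact: word_eq_1r. Qed.

HB.instance Definition _ := isUMagmaMorphism.Build G freeprod fp_inl
  (pair fp_inl1 fp_inlM).
HB.instance Definition _ := isUMagmaMorphism.Build H freeprod fp_inr
  (pair fp_inr1 fp_inrM).

Lemma fp_pi_cons l s : \pi_freeprod (l :: s) =
  (match l with inl a => fp_inl a | inr b => fp_inr b end) * \pi_freeprod s.
Proof. by case: l => a; rewrite fp_piM. Qed.

Section Lift.
Variables (K : groupType).
Variables (f : UMagmaMorphism.type G K) (g : UMagmaMorphism.type H K).

Definition lift_letter (l : G + H) : K :=
  match l with inl a => f a | inr b => g b end.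

(* The common extension of f and g, i.e. the universal property of G * H. *)
Definition fp_lift (u : freeprod) : K := \prod_(l <- repr u) lift_letter l.

Lemma lift_word_eq s t : word_eq s t ->
  \prod_(l <- s) lift_letter l = \prod_(l <- t) lift_letter l.
Proof.
elim=> {s t} //.
- by move=> s t r _ -> _ ->.
- by move=> s s' t t' _ ss _ tt; rewrite !big_cat /= ss tt.
- by rewrite big_seq1 big_nil /= gmulf1.
- by rewrite big_seq1 big_nil /= gmulf1.
- by move=> a b; rewrite big_cons !big_seq1 /= gmulfM.
- by move=> a b; rewrite big_cons !big_seq1 /= gmulfM.
Qed.

Lemma fp_lift_pi s : fp_lift (\pi_freeprod s) = \prod_(l <- s) lift_letter l.
Proof. by apply: lift_word_eq; exact: fp_repr. Qed.

Lemma fp_liftM : {morph fp_lift : u v / u * v}.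
Proof.
move=> u v; have [s ->] := fp_surj u; have [t ->] := fp_surj v.
by rewrite fp_piM !fp_lift_pi big_cat.
Qed.
Lemma fp_lift1 : fp_lift 1 = 1.
Proof. by rewrite fp_lift_pi big_nil. Qed.

HB.instance Definition _ := isUMagmaMorphism.Build freeprod K fp_lift
  (pair fp_lift1 fp_liftM).

Lemma fp_lift_inl a : fp_lift (fp_inl a) = f a.
Proof. by rewrite fp_lift_pi big_seq1. Qed.
Lemma fp_lift_inr b : fp_lift (fp_inr b) = g b.
Proof. by rewrite fp_lift_pi big_seq1. Qed.

Lemma fp_lift_unique (h : UMagmaMorphism.type freeprod K) :
  (forall a, h (fp_inl a) = f a) -> (forall b, h (fp_inr b) = g b) ->
  h =1 fp_lift.
Proof.
move=> hl hr u; have [s ->] := fp_surj u; rewrite fp_lift_pi;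
  elim: s => [|l s IHs].
  by rewrite big_nil; exact: (gmulf1 (s := h)).
by rewrite fp_pi_cons big_cons gmulfM IHs; case: l => a; rewrite /= ?hl ?hr.
Qed.

End Lift.
End FreeProduct.

(* The infinite cyclic group, written multiplicatively: the integer n stands
   for the n-th power of the generator. *)
Definition infcyclic : Type := int.
HB.instance Definition _ := Choice.on infcyclic.
HB.instance Definition _ := @isGroup.Build infcyclic
  (0%R : int) (fun m : int => - m)%R (fun m n : int => m + n)%R
  (@addrA int) (@add0r int) (@addr0 int) (@addNr int) (@addrN int).

Definition infcyclic_gen : infcyclic := (1%R : int).

Definition zexpg (G : groupType) (g : G) (n : int) : G :=
  match n with Posz m => g ^+ m | Negz m => g ^- m.+1 end.

Lemma zexpg1 (G : groupType) (g : G) : zexpg g 1%R = g.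
Proof. by []. Qed.

Lemma zexpgD (G : groupType) (g : G) (m n : int) :
  zexpg g (m + n)%R = zexpg g m * zexpg g n.
Proof.
have S k : zexpg g (k + 1)%R = zexpg g k * g.
  case: k => k.
    have -> : (Posz k + 1 = Posz k.+1)%R by rewrite -PoszD addn1.
    by rewrite /= expgSr.
  rewrite NegzE; case: k => [|k].
    by rewrite addNr /= expg1 mulVg.
  have -> : (- Posz k.+2 + 1 = - Posz k.+1)%R.
    by rewrite -[k.+2]addn1 PoszD opprD addrNK.
  by rewrite -!NegzE /= [g ^+ k.+2]expgS invgM mulgVK.
have P k : zexpg g (k - 1)%R = zexpg g k * g^-1.
  by rewrite -{2}[k](subrK 1%R) S mulgK.
elim/int_rect: n => [|n IHn|n IHn].
- by rewrite addr0 mulg1.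
- by rewrite -[n.+1]addn1 PoszD addrA !S IHn mulgA.
- by rewrite -[n.+1]addn1 PoszD opprD addrA !P IHn mulgA.
Qed.

Lemma zexpg_gen (n : int) : zexpg infcyclic_gen n = n.
Proof.
have expE k : infcyclic_gen ^+ k = Posz k.
  by elim: k => // k IHk; rewrite expgS IHk -add1n PoszD.
by case: n => n; rewrite /= expE.
Qed.

Section PowerMorphism.
Variables (G : groupType) (g : G).
Definition power_of (n : infcyclic) : G := zexpg g n.
Lemma power_ofM : {morph power_of : m n / m * n}.
Proof. exact: zexpgD. Qed.
Lemma power_of1 : power_of 1 = 1.
Proof. by []. Qed.
HB.instance Definition _ := isUMagmaMorphism.Build infcyclic G power_of
  (pair power_of1 power_ofM).
End PowerMorphism.

Section Words.
Variable G : groupType.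

Definition fpX : freeprod G infcyclic := fp_inr G infcyclic_gen.

(* The element g_1 x^{n_1} ... g_k x^{n_k} of G * <x>. *)
Definition word (w : seq (G * int)) : freeprod G infcyclic :=
  \prod_(p <- w) (fp_inl infcyclic p.1 * zexpg fpX p.2).

Definition unimodular (u : freeprod G infcyclic) : Prop :=
  exists w : seq (G * int), u = word w /\
    ((\sum_(p <- w) p.2)%R = 1%R \/ (\sum_(p <- w) p.2)%R = (-1)%R).

(* u(g): the homomorphism that is the identity on G and sends x to g. *)
Definition subst (u : freeprod G infcyclic) (g : G) : G :=
  fp_lift idfun (power_of g) u.

Lemma subst_inl a g : subst (fp_inl infcyclic a) g = a.
Proof. exact: fp_lift_inl. Qed.

Lemma subst_X g : subst fpX g = g.
Proof. exact: fp_lift_inr. Qed.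

Lemma subst_word w g : subst (word w) g = \prod_(p <- w) (p.1 * zexpg g p.2).
Proof.
rewrite /subst gmulf_prod; apply: eq_bigr => p _.
rewrite gmulfM /= fp_lift_inl; congr (_ * _).
by case: p.2 => n; rewrite /= ?gmulfV gmulfXn /= fp_lift_inr.
Qed.

(* The exponent sum depends only on the element, not on the chosen word. *)
Definition expsum (u : freeprod G infcyclic) : int :=
  fp_lift (@one_fun G infcyclic) idfun u.

Lemma expsum_word w : expsum (word w) = (\sum_(p <- w) p.2)%R.
Proof.
have X n : expsum (zexpg fpX n) = n.
  rewrite -[RHS]zexpg_gen /expsum.
  by case: n => n; rewrite /= ?gmulfV gmulfXn /= fp_lift_inr.
rewrite /expsum gmulf_prod; apply: (big_ind2 (fun a b : int => a = b)) => //.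
  by move=> a b c d -> ->.
move=> p _; rewrite gmulfM /= fp_lift_inl mul1g; exact: X.
Qed.

Lemma word_surj u : exists w, u = word w.
Proof.
have step l s : exists w, \pi_(freeprod G infcyclic) (l :: s) =
   word w * \pi_(freeprod G infcyclic) s.
  rewrite fp_pi_cons; case: l => a.
    by exists [:: (a, 0%R)]; rewrite /word big_seq1 /= mulg1.
  exists [:: (1, (a : int))]; rewrite /word big_seq1 /= gmulf1 mul1g.
  congr (_ * _).
  have E (n : int) : fp_inr G (zexpg infcyclic_gen n) = zexpg fpX n.
    by case: n => n; rewrite /= ?gmulfV gmulfXn.
  by rewrite -E zexpg_gen.
have [s ->] := fp_surj u; elim: s => [|l s [w IHs]].
  by exists [::]; rewrite /word big_nil.
have [w' ->] := step l s; exists (w' ++ w).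
by rewrite IHs /word big_cat.
Qed.

Lemma unimodularE u : unimodular u <-> expsum u = 1%R \/ expsum u = (-1)%R.
Proof.
split; first by move=> [w [-> Hw]]; rewrite expsum_word.
by have [w ->] := word_surj u; rewrite expsum_word => Hw; exists w.
Qed.

End Words.

(* Main.v *)
(* G is Thompson's group V, acting on a set X identified with two disjoint copies
   of itself by the bijections that locally replace prefixes. Let K be the
   subgroup of the elements supported in one half of X. Moving a single small
   cone shows that V = r K r^-1 . K . r K r^-1 . K for one fixed r. Put four elements
   k1, ..., k4 of K side by side in four disjoint cones to get an element x; then a
   product of conjugates of x, x^-1, x, x^-1, x, x^-1, x by suitable constants
   telescopes to (r k1 r^-1) k2 (r k3 r^-1) k4, because the constants may
   place the unused blocks of neighbouring factors at the same spots. So this word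
   of exponent sum 1 is surjective, and it is not injective because the
   factorization is far from unique. *)
Require Import Defs.
From HB Require Import structures.
From mathcomp Require Import all_boot all_algebra.
From mathcomp Require Import boolp classical_sets.

Set Implicit Arguments.
Unset Strict Implicit.
Unset Printing Implicit Defensive.

Local Notation bits := (seq bool).
Local Notation O := false.
Local Notation I := true.

(** * Cones *)

(* The pairs [(b, n)] are encoded by [b + 2 n], so that the cone of a word of
   length k, i.e. the range of [into w], is a residue class modulo 2 ^ k. *)
Definition into (w : bits) (x : nat) : nat :=
  foldr (fun (b : bool) n => b + n.*2) x w.

Lemma into_cat a b x : into (a ++ b) x = into a (into b x).
Proof. exact: foldr_cat. Qed.

Lemma into_split n x : exists w y, size w = n /\ x = into w y.
Proof.
elim: n x => [|n IHn] x; first by exists [::], x.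
have [w [y [sw xE]]] := IHn x./2.
by exists (odd x :: w), y; rewrite /= sw -xE odd_double_half.
Qed.

Fixpoint strip (w : bits) (x : nat) : option nat :=
  if w is b :: w' then if odd x == b then strip w' x./2 else None
  else Some x.

Lemma strip_into w x : strip w (into w x) = Some x.
Proof.
by elim: w => //= b w IHw; rewrite half_bit_double oddD odd_double addbF oddb eqxx.
Qed.

Lemma strip_some w x y : strip w x = Some y -> x = into w y.
Proof.
elim: w x => [|b w IHw] x /=; first by case.
by case: eqP => // <- /IHw <-; rewrite odd_double_half.
Qed.

(** Incomparability in the prefix order amounts to disjointness of the two cones. *)
Definition incomp (a b : bits) := ~~ prefix a b && ~~ prefix b a.

Lemma incompC a b : incomp a b = incomp b a.
Proof. exact: andbC. Qed.

Lemma prefix_total (a b c : bits) :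
  prefix a c -> prefix b c -> prefix a b || prefix b a.
Proof.
elim: a b c => [|x a IHa] [|y b] [|z c] //=.
by case: eqP => // -> /= pa; case: eqP => // -> /= pb; rewrite eqxx /= (IHa _ c).
Qed.

Lemma incomp_cat a b c d : incomp a b -> incomp (a ++ c) (b ++ d).
Proof.
move=> /andP[ab ba]; apply/andP; split; apply/negP => p.
  have := prefix_total (prefix_trans (prefix_prefix a c) p) (prefix_prefix b d).
  by rewrite (negPf ab) (negPf ba).
have := prefix_total (prefix_trans (prefix_prefix b d) p) (prefix_prefix a c).
by rewrite (negPf ab) (negPf ba).
Qed.

Lemma incomp_cat2l a b c : incomp (a ++ b) (a ++ c) = incomp b c.
Proof. by elim: a => // x a IHa; rewrite /incomp /= !eqxx. Qed.

Lemma incomp_size a b : size a = size b -> incomp a b = (a != b).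
Proof.
by move=> s; rewrite /incomp !prefixE s take_size -s take_size eq_sym andbb.
Qed.

Lemma incompxx a : incomp a a = false.
Proof. by rewrite /incomp prefix_refl. Qed.

Lemma incomp_into a b x y : incomp a b -> into a x <> into b y.
Proof.
elim: a b => [|c a IHa] [|d b] //=; rewrite /incomp ?prefix0s //=.
case: (eqVneq c d) => [->|cd] /=.
  by move=> ab /addnI /double_inj; apply: IHa.
move=> _ /(congr1 odd); rewrite !oddD !odd_double !addbF !oddb => e.
by rewrite e eqxx in cd.
Qed.

Lemma strip_incomp a b x : incomp a b -> strip a (into b x) = None.
Proof.
move=> ab; case E: (strip _ _) => [y|] //.
by case: (incomp_into ab (esym (strip_some E))).
Qed.

(** * Thompson's group V *)

Definition sends (f : nat -> nat) (a b : bits) : Prop :=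
  forall x, f (into a x) = into b x.

(** A uniform depth is no restriction: any finite partition into cones on which [f] replaces
    prefixes refines to a full level. *)
Definition local (f : nat -> nat) : Prop :=
  exists n, forall w, size w = n -> exists u, sends f w u.

Lemma sends_cat f a b c : sends f a b -> sends f (a ++ c) (b ++ c).
Proof. by move=> fab x; rewrite !into_cat fab. Qed.

(** On a word of length [m + n], [g] keeps the last [n] letters, so the image word is long enough
    for [f] to act on it by replacing a prefix. *)
Lemma local_comp f g : local f -> local g -> local (f \o g).
Proof.
move=> [n fn] [m gm]; exists (m + n) => w sw.
have [|u gu] := gm (take m w); first by rewrite size_takel // sw leq_addr.
have sd : size (drop m w) = n by rewrite size_drop sw addKn.
have gw : sends g w (u ++ drop m w) by rewrite -{1}(cat_take_drop m w); apply: sends_cat.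
have [|v fv] := fn (take n (u ++ drop m w)).
  by rewrite size_takel // size_cat sd leq_addl.
exists (v ++ drop n (u ++ drop m w)) => x /=.
by rewrite gw -{1}(cat_take_drop n (u ++ _)); apply: sends_cat.
Qed.

(** The depth is the maximal length of the image words [u w]. A word [v] of that length shares a
    point with the cone of some [u w], hence extends [u w], and [g] puts [w] back in place of that
    prefix. *)
Lemma local_inv f g : cancel f g -> cancel g f -> local f -> local g.
Proof.
move=> fK gK [n fn].
have /choice[u fu] : forall w : n.-tuple bool, exists u, sends f w u.
  by move=> w; apply: fn; rewrite size_tuple.
exists (\max_w size (u w)) => v sv.
have [w [y [sw xE]]] := into_split n (g (into v 0)).
have /eqP sw' := sw; have e := fu (Tuple sw') y; rewrite /= -xE gK in e.
have le : size (u (Tuple sw')) <= size v.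
  by rewrite sv (leq_bigmax (F := fun w => size (u w))).
have pv : prefix (u (Tuple sw')) v.
  apply: contraT => np; have : incomp (u (Tuple sw')) v.
    rewrite /incomp np /=; apply: contra np => p.
    have /prefixP[s us] := p.
    have : size s == 0 by rewrite -leqn0 -(leq_add2l (size v)) addn0 -size_cat -us.
    by rewrite size_eq0 => /eqP s0; rewrite us s0 cats0 prefix_refl.
  by move=> i; case: (incomp_into i (esym e)).
case/prefixP: pv => s vE; exists (w ++ s) => x.
by rewrite {1}vE !into_cat -(fu (Tuple sw')) fK.
Qed.

Definition thompson_pred (fg : (nat -> nat) * (nat -> nat)) : Prop :=
  [/\ cancel fg.1 fg.2, cancel fg.2 fg.1 & local fg.1].

Definition thompson := {fg | thompson_pred fg}.

HB.instance Definition _ := gen_eqMixin thompson.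
HB.instance Definition _ := gen_choiceMixin thompson.

Definition ev (v : thompson) : nat -> nat := (sval v).1.

Lemma ev_inj u v : ev u =1 ev v -> u = v.
Proof.
case: u v => [[f f'] p] [[g g'] q] /funext /= e; apply: eq_exist.
rewrite /ev /= in e; subst g; congr (_, _); apply: funext => x.
case: p q => /= [fK _ _] [_ /= gK _].
by rewrite -{1}(gK x) fK.
Qed.

Lemma tone_subproof : thompson_pred (id, id).
Proof. by split=> //; exists 0 => w _; exists w. Qed.
Definition tone : thompson := exist _ _ tone_subproof.

Lemma tmul_subproof (u v : thompson) :
  thompson_pred ((sval u).1 \o (sval v).1, (sval v).2 \o (sval u).2).
Proof.
case: u v => [fg [fK gK lf]] [fg' [fK' gK' lf']]; split=> /=.
- exact: can_comp.
- exact: can_comp.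
- exact: local_comp.
Qed.
Definition tmul (u v : thompson) : thompson := exist _ _ (tmul_subproof u v).

Lemma tinv_subproof (v : thompson) : thompson_pred ((sval v).2, (sval v).1).
Proof. by case: v => [fg [fK gK lf]]; split=> //; apply: (local_inv fK gK). Qed.
Definition tinv (v : thompson) : thompson := exist _ _ (tinv_subproof v).

Lemma tmulA : associative tmul. Proof. by move=> u v w; apply: ev_inj. Qed.
Lemma tmul1 : left_id tone tmul. Proof. by move=> u; apply: ev_inj. Qed.
Lemma tmulr1 : right_id tone tmul. Proof. by move=> u; apply: ev_inj. Qed.
Lemma tmulV : left_inverse tone tinv tmul.
Proof. by move=> [fg [fK gK lf]]; apply: ev_inj. Qed.
Lemma tmulrV : right_inverse tone tinv tmul.
Proof. by move=> [fg [fK gK lf]]; apply: ev_inj. Qed.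

HB.instance Definition _ :=
  isGroup.Build thompson tmulA tmul1 tmulr1 tmulV tmulrV.

Local Open Scope group_scope.

Lemma evM (u v : thompson) x : ev (u * v) x = ev u (ev v x).
Proof. by []. Qed.

Lemma evK (v : thompson) : cancel (ev v) (ev v^-1).
Proof. by move=> x; rewrite -evM mulVg. Qed.

Lemma evVK (v : thompson) : cancel (ev v^-1) (ev v).
Proof. by move=> x; rewrite -evM mulgV. Qed.

Definition maps (v : thompson) := sends (ev v).

Lemma maps_cat v a b c : maps v a b -> maps v (a ++ c) (b ++ c).
Proof. exact: sends_cat. Qed.

Lemma maps1 a : maps 1 a a. Proof. by []. Qed.

Lemma mapsM u v a b c : maps u b c -> maps v a b -> maps (u * v) a c.
Proof. by move=> ubc vab x; rewrite evM vab ubc. Qed.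

Lemma mapsV v a b : maps v a b -> maps v^-1 b a.
Proof. by move=> vab x; rewrite -vab evK. Qed.

Lemma maps_incomp v a a' b b' :
  maps v a a' -> maps v b b' -> incomp a b -> incomp a' b'.
Proof.
move=> va vb ab; apply/andP; split; apply/negP => /prefixP[s e].
  have /(_ 0%N) := vb; rewrite e into_cat -va => /(can_inj (evK v)) /esym.
  exact: incomp_into.
have /(_ 0%N) := va; rewrite e into_cat -vb => /(can_inj (evK v)).
exact: incomp_into.
Qed.

Lemma maps_split v a b :
  (forall c, maps v (rcons a c) (rcons b c)) -> maps v a b.
Proof.
move=> h x; have := h (odd x) x./2; rewrite -!cats1 !into_cat /=.
by rewrite odd_double_half.
Qed.

Lemma maps_local (v : thompson) :
  exists n, forall w, size w = n -> exists u, maps v w u.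
Proof. by case: v => [fg [fK gK lf]]. Qed.

(** * Prefix exchanges *)

Definition swapf (a b : bits) (x : nat) : nat :=
  if ~~ incomp a b then x
  else if strip a x is Some y then into b y
  else if strip b x is Some y then into a y
  else x.

Lemma swapf_l a b : incomp a b -> sends (swapf a b) a b.
Proof. by move=> ab x; rewrite /swapf ab strip_into. Qed.

Lemma swapf_r a b : incomp a b -> sends (swapf a b) b a.
Proof. by move=> ab x; rewrite /swapf ab strip_incomp // strip_into. Qed.

Lemma swapf_out a b c : incomp a c -> incomp b c -> sends (swapf a b) c c.
Proof. by move=> ac bc x; rewrite /swapf !strip_incomp // if_same. Qed.

Lemma swapfK a b : involutive (swapf a b).
Proof.
move=> x; case ab: (incomp a b); last by rewrite /swapf ab.
case Ea: (strip a x) => [y|]; first by rewrite (strip_some Ea) swapf_l ?swapf_r.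
case Eb: (strip b x) => [y|]; first by rewrite (strip_some Eb) swapf_r ?swapf_l.
by rewrite /swapf ab /= !(Ea, Eb).
Qed.

Lemma prefix_or_incomp (a w : bits) :
  size a <= size w -> prefix a w \/ incomp a w.
Proof.
move=> s; case: (boolP (prefix a w)) => [|np]; [by left | right].
rewrite /incomp np /=; apply: contra np; rewrite prefixE take_oversize // => /eqP ->.
exact: prefix_refl.
Qed.

Lemma swapf_local a b : local (swapf a b).
Proof.
case ab: (incomp a b); last by exists 0 => w _; exists w => x; rewrite /swapf ab.
exists (size a + size b) => w sw.
have la : size a <= size w by rewrite sw leq_addr.
have [/prefixP[s ->]|aw] := prefix_or_incomp la.
  by exists (b ++ s); apply/sends_cat/swapf_l.
have lb : size b <= size w by rewrite sw leq_addl.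
have [/prefixP[s ->]|bw] := prefix_or_incomp lb.
  by exists (a ++ s); apply/sends_cat/swapf_r.
by exists w; apply: swapf_out.
Qed.

Lemma swap_subproof a b : thompson_pred (swapf a b, swapf a b).
Proof. by split; [apply: swapfK | apply: swapfK | apply: swapf_local]. Qed.

(* The identity when the cones of [a] and [b] intersect. *)
Definition swap a b : thompson := exist _ _ (swap_subproof a b).

Lemma swap_l a b : incomp a b -> maps (swap a b) a b.
Proof. exact: swapf_l. Qed.

Lemma swap_r a b : incomp a b -> maps (swap a b) b a.
Proof. exact: swapf_r. Qed.

Lemma swap_out a b c : incomp a c -> incomp b c -> maps (swap a b) c c.
Proof. exact: swapf_out. Qed.

Lemma swapV a b : (swap a b)^-1 = swap a b.
Proof. by apply: ev_inj. Qed.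

Lemma swapK a b : swap a b * swap a b = 1.
Proof. by rewrite -{1}swapV mulVg. Qed.

Lemma swap_id a b : ~~ incomp a b -> swap a b = 1.
Proof. by move=> ab; apply: ev_inj => x; rewrite /ev /= /swapf ab. Qed.

(** Only the effect of [v] on the two cones matters: a point outside the cones of [a'] and [b']
    comes from outside those of [a] and [b], where the exchange does nothing. *)
Lemma swap_conj v a b a' b' : incomp a b -> maps v a a' -> maps v b b' ->
  v * swap a b * v^-1 = swap a' b'.
Proof.
move=> ab va vb; have ab' := maps_incomp va vb ab.
apply: ev_inj => z; rewrite !evM.
case Ea: (strip a' z) => [y|].
  by rewrite (strip_some Ea) (mapsV va) (swap_l ab) vb (swap_l ab').
case Eb: (strip b' z) => [y|].
  by rewrite (strip_some Eb) (mapsV vb) (swap_r ab) va (swap_r ab').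
rewrite [ev (swap a b) _]/ev /= /swapf ab /=.
case Fa: (strip a _) => [y|].
  by move: Ea; rewrite -(evVK v z) (strip_some Fa) va strip_into.
case Fb: (strip b _) => [y|].
  by move: Eb; rewrite -(evVK v z) (strip_some Fb) vb strip_into.
by rewrite evVK /ev /= /swapf Ea Eb if_same.
Qed.

(** Serves to trade an exchange for two exchanges of longer words. *)
Lemma swap_split a b : incomp a b ->
  swap a b = swap (rcons a false) (rcons b false)
           * swap (rcons a true) (rcons b true).
Proof.
move=> ab; have inc c d : incomp (rcons a c) (rcons b d).
  by rewrite -!cats1 incomp_cat.
have same (w : bits) : incomp (rcons w true) (rcons w false).
  by rewrite -!cats1 incomp_cat2l.
have sC (w : bits) : incomp (rcons w false) (rcons w true) by rewrite incompC.
have ba : incomp b a by rewrite incompC.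
have inc' c d : incomp (rcons b c) (rcons a d) by rewrite incompC.
have intoE w y : into w y = into (rcons w (odd y)) y./2.
  by rewrite -cats1 into_cat /= odd_double_half.
apply: ev_inj => z; rewrite evM.
case Ea: (strip a z) => [y|].
  rewrite (strip_some Ea) (swap_l ab) (intoE a y) (intoE b y); case: (odd y).
    by rewrite (swap_l (inc _ _)) (swap_out (inc _ _) (sC _)).
  by rewrite (swap_out (same _) (inc' _ _)) (swap_l (inc _ _)).
case Eb: (strip b z) => [y|].
  rewrite (strip_some Eb) (swap_r ab) (intoE a y) (intoE b y); case: (odd y).
    by rewrite (swap_r (inc _ _)) (swap_out (sC _) (inc' _ _)).
  by rewrite (swap_out (inc _ _) (same _)) (swap_r (inc _ _)).
have strip_rcons w c : strip w z = None -> strip (rcons w c) z = None.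
  elim: w z {Ea Eb} => //= d w IHw z; case: ifP => // _; exact: IHw.
by rewrite /ev /= /swapf ab !inc /= !strip_rcons // Ea Eb.
Qed.

(** * Products of exchanges *)

Definition swaps (l : seq (bits * bits)) : thompson :=
  \prod_(p <- l) swap p.1 p.2.

Definition swapw (a b w : bits) : bits :=
  if prefix a w then b ++ drop (size a) w
  else if prefix b w then a ++ drop (size b) w else w.

Definition swap_ok (a b w : bits) : bool :=
  incomp a b && [|| prefix a w, prefix b w | incomp a w && incomp b w].

Lemma maps_swap a b w : swap_ok a b w -> maps (swap a b) w (swapw a b w).
Proof.
rewrite /swap_ok /swapw => /andP[ab].
case: (boolP (prefix a w)) => [/prefixP[s ->] _|_ /=].
  by rewrite drop_size_cat //; apply/maps_cat/swap_l.
case: (boolP (prefix b w)) => [/prefixP[s ->] _|_ /= /andP[aw bw]].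
  by rewrite drop_size_cat //; apply/maps_cat/swap_r.
exact: swap_out.
Qed.

(** The rightmost factor acts first; [None] means that [swap_ok] failed at some stage, for instance
    because the word became too short. *)
Fixpoint swapsw (l : seq (bits * bits)) (w : bits) : option bits :=
  if l is p :: l' then
    if swapsw l' w is Some u then
      if swap_ok p.1 p.2 u then Some (swapw p.1 p.2 u) else None
    else None
  else Some w.

Lemma maps_swaps l w u : swapsw l w = Some u -> maps (swaps l) w u.
Proof.
elim: l u => [|p l IHl] u /=; first by case=> <-; rewrite /swaps big_nil.
case: (swapsw l w) IHl => [t|] // IHl; case: ifP => // ok [<-].
by rewrite /swaps big_cons; apply: mapsM (IHl _ _) => //; apply: maps_swap.
Qed.

Fixpoint words (n : nat) : seq bits :=
  if n is n'.+1 then [seq b :: w | b <- [:: false; true], w <- words n']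
  else [:: [::]].

Lemma mem_words n w : (w \in words n) = (size w == n).
Proof.
elim: n w => [|n IHn] w; first by rewrite inE size_eq0.
apply/allpairsP/idP => [[[b v] /= [_]]|]; first by rewrite IHn => ? ->.
by case: w => [|b w] //; rewrite eqSS -IHn => wn; exists (b, w); split=> //; case: b.
Qed.

(** Turns an identity in an infinite group into a finite computation, since the cones of depth [n]
    cover everything. *)
Lemma swaps_eq n l l' :
  all (fun w => if swapsw l w is Some u then swapsw l' w == Some u else false)
    (words n) ->
  swaps l = swaps l'.
Proof.
move=> /allP h; apply: ev_inj => x.
have [w [y [sw ->]]] := into_split n x.
have := h w; rewrite mem_words sw eqxx => /(_ isT).
case E: (swapsw l w) => [u|] // /eqP E'.
by rewrite (maps_swaps E) (maps_swaps E').
Qed.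

(** * Generation by exchanges *)

Definition covers (P : seq bits) : Prop :=
  forall x, exists w, w \in P /\ exists y, x = into w y.

Definition antichain (P : seq bits) : Prop :=
  forall a b, a \in P -> b \in P -> a <> b -> incomp a b.

Lemma prefix_antichain P a b :
  antichain P -> a \in P -> b \in P -> prefix a b -> a = b.
Proof.
move=> anti aP bP ab; apply: contrapT => /(anti _ _ aP bP).
by rewrite /incomp ab.
Qed.

Lemma longest (P : seq bits) : P != [::] ->
  exists2 w, w \in P & forall v, v \in P -> size v <= size w.
Proof.
elim: P => // a P IHP _; have [->|/IHP[w wP wmax]] := eqVneq P [::].
  by exists a; rewrite ?mem_head // => v; rewrite inE => /eqP ->.
have [le|lt] := leqP (size a) (size w).
  exists w; first by rewrite inE wP orbT.
  by move=> v; rewrite inE => /predU1P[->|/wmax].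
exists a; first exact: mem_head.
move=> v; rewrite inE => /predU1P[->//|/wmax le].
exact: leq_trans le (ltnW lt).
Qed.

(* The parent of a longest word of P works. *)
Lemma siblings P : covers P -> antichain P -> [::] \notin P ->
  exists a, rcons a false \in P /\ rcons a true \in P.
Proof.
move=> cov anti nilP.
have [|w wP wmax] := @longest P.
  by apply/eqP => P0; have [w [+ _]] := cov 0; rewrite P0.
case/lastP: w wP wmax => [nP|a b abP amax]; first by rewrite nP in nilP.
suff sib : rcons a (~~ b) \in P by exists a; case: b abP sib {amax}.
(* Some [v] in [P] covers the first point of the sibling's cone. By maximality it is a prefix of the
   sibling; a proper one would also be a prefix of [rcons a b], against the antichain condition. *)
have [v [vP [y e]]] := cov (into (rcons a (~~ b)) 0).
have pv : prefix v (rcons a (~~ b)).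
  have le : size v <= size (rcons a (~~ b)) by rewrite size_rcons -(size_rcons a b) amax.
  have [//|i] := prefix_or_incomp le.
  by case: (incomp_into i (esym e)).
have [->//|ne] := eqVneq (rcons a (~~ b)) v.
have va : prefix v a.
  move: pv; rewrite prefixE => /eqP vE.
  have le : size v <= size a.
    rewrite leqNgt; apply: contra ne => lt.
    by rewrite -vE take_oversize // size_rcons.
  by move: vE; rewrite -cats1 takel_cat // => <-; apply: prefix_take.
have vab := prefix_antichain anti vP abP (prefix_trans va (prefix_rcons a b)).
by have := size_prefix va; rewrite vab size_rcons ltnn.
Qed.

Section Subgroup.

Variable H : set thompson.
Hypothesis Hsub : is_subgroup H.

Let H1 : H 1. Proof. by case: Hsub. Qed.
Let HM u v : H u -> H v -> H (u * v). Proof. by case: Hsub => _ + _; apply. Qed.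
Let HV u : H u -> H u^-1. Proof. by case: Hsub => _ _; apply. Qed.

Lemma swap_antichain Q a b c : antichain Q -> a \in Q -> b \in Q -> c \in Q ->
  exists2 d, d \in Q & maps (swap a b) c d.
Proof.
move=> anti aQ bQ cQ; have [<-|/eqP ab] := eqVneq a b.
  by exists c => //; rewrite swap_id ?incompxx.
have iab := anti _ _ aQ bQ ab.
have [->|/eqP ca] := eqVneq c a; first by exists b => //; apply: swap_l.
have [->|/eqP cb] := eqVneq c b; first by exists a => //; apply: swap_r.
by exists c => //; apply: swap_out; apply: anti => //; apply: nesym.
Qed.

Lemma swap_move Q a b : antichain Q -> a \in Q -> b \in Q -> maps (swap a b) a b.
Proof.
move=> anti aQ bQ; have [<-|/eqP ab] := eqVneq a b.
  by rewrite swap_id ?incompxx.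
exact/swap_l/anti.
Qed.

(* Induction on the size of P: two exchanges of image cones align a pair of
   sibling cones of the domain with a pair of sibling cones of the image, and
   each pair may then be merged. *)
Lemma swap_generation_on P v :
  (forall a b, incomp a b -> H (swap a b)) ->
  uniq P -> covers P -> antichain P ->
  (forall w, w \in P -> exists u, maps v w u) -> H v.
Proof.
move=> Hswap; have Hsw a b : H (swap a b).
  by have [/Hswap//|/swap_id ->] := boolP (incomp a b).
have [n] := ubnP (size P); elim: n P v => // n IHn P v sP uP cov anti mapsP.
have [nilP|nilP] := boolP ([::] \in P).
  have [u vu] := mapsP _ nilP.
  case: u vu => [|b u] vu; first by rewrite (_ : v = 1) //; apply: ev_inj => x; apply: vu.
  (* Surjectivity of [v] excludes this case: the number [~~ b] has the wrong parity to lie in the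
     cone of [b :: u]. *)
  have := vu (ev v^-1 (~~ b)); rewrite [X in ev v X]/= evVK /=.
  by move/(congr1 odd); rewrite oddD odd_double addbF !oddb; case: b {vu}.
have /choice[phi phiP] : forall w, exists u, w \in P -> maps v w u.
  by move=> w; have [/mapsP[u]|] := boolP (w \in P); [exists u | exists w].
pose Q := map phi P.
have antiQ : antichain Q.
  move=> _ _ /mapP[a aP ->] /mapP[b bP ->] ne.
  apply: (maps_incomp (phiP _ aP) (phiP _ bP)); apply: anti => // ab.
  by rewrite ab in ne.
have covQ : covers Q.
  move=> x; have [w [wP [y e]]] := cov (ev v^-1 x).
  exists (phi w); split; first exact: map_f.
  by exists y; rewrite -phiP // -e evVK.
have nilQ : [::] \notin Q.
  apply/mapP => -[w wP e]; case: w wP e => [|b w] wP e; first by rewrite wP in nilP.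
  have := phiP _ wP (ev v (~~ b)); rewrite -e => /(can_inj (evK v)) /=.
  by move/(congr1 odd); rewrite oddD odd_double addbF !oddb; case: b {wP e}.
have [a [a0 a1]] := siblings cov anti nilP.
have [c [c0 c1]] := siblings covQ antiQ nilQ.
have neF (w : bits) : rcons w true <> rcons w false by move/rcons_inj.
have q0 : phi (rcons a false) \in Q by apply: map_f.
pose s := swap (phi (rcons a false)) (rcons c false).
have s0 : maps (s * v) (rcons a false) (rcons c false).
  exact: mapsM (swap_move antiQ q0 c0) (phiP _ a0).
have [q1 q1Q s1] : exists2 q, q \in Q & maps (s * v) (rcons a true) q.
  have [q qQ sq] := swap_antichain antiQ q0 c0 (map_f phi a1).
  by exists q => //; apply: mapsM sq (phiP _ a1).
have i01 : incomp q1 (rcons c false).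
  by apply: maps_incomp s1 s0 _; apply: anti => //; apply: neF.
pose t := swap q1 (rcons c true).
have t0 : maps (t * (s * v)) (rcons a false) (rcons c false).
  by apply: mapsM s0; apply: swap_out => //; apply: antiQ => //; apply: neF.
have t1 : maps (t * (s * v)) (rcons a true) (rcons c true).
  by apply: mapsM s1; apply: (swap_move antiQ).
suff Htsv : H (t * (s * v)).
  by rewrite -(mulKg s v) -(mulKg t (s * v)); do 2!apply: HM (HV (Hsw _ _)) _.
have uP0 := rem_uniq (rcons a false) uP.
have memR w : (w \in rem (rcons a true) (rem (rcons a false) P)) =
    [&& w != rcons a true, w != rcons a false & w \in P].
  by rewrite mem_rem_uniq // inE mem_rem_uniq // inE.
have antia w : w \in rem (rcons a true) (rem (rcons a false) P) -> incomp a w.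
  rewrite memR => /and3P[/eqP w1 /eqP w0 wP].
  apply/andP; split; apply/negP.
    case/prefixP=> -[|b r] wE; last first.
      have abP : rcons a b \in P by case: (b).
      have p : prefix (rcons a b) w by rewrite wE -cat_rcons prefix_prefix.
      have := prefix_antichain anti abP wP p.
      by case: (b) => e; [apply: w1 | apply: w0].
    rewrite cats0 in wE; apply: w0; apply: prefix_antichain anti wP a0 _.
    by rewrite wE prefix_rcons.
  move=> wa; apply: w0; apply: prefix_antichain anti wP a0 _.
  exact: prefix_trans wa (prefix_rcons _ _).
have aR : a \notin rem (rcons a true) (rem (rcons a false) P).
  by apply/negP => /antia; rewrite incompxx.
apply: (IHn (a :: rem (rcons a true) (rem (rcons a false) P))).
- have a1' : rcons a true \in rem (rcons a false) P.
    by rewrite mem_rem_uniq // inE a1 andbT; apply/eqP/neF.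
  rewrite /= size_rem // size_rem //.
  have : 0 < size (rem (rcons a false) P) by case: (rem _ _) a1'.
  by rewrite size_rem //; case: (size P) sP => [|[|k]].
- by rewrite /= aR !rem_uniq.
- move=> x; have [w [wP [y ->]]] := cov x.
  have [->|w1] := eqVneq w (rcons a true).
    exists a; split; first exact: mem_head.
    by exists (into [:: true] y); rewrite -into_cat cats1.
  have [->|w0] := eqVneq w (rcons a false).
    exists a; split; first exact: mem_head.
    by exists (into [:: false] y); rewrite -into_cat cats1.
  by exists w; rewrite inE memR w1 w0 wP orbT; split=> //; exists y.
- move=> w w'; rewrite !inE => /predU1P[->|wR] /predU1P[->|wR'] //.
  + by move=> _; apply: antia.
  + by rewrite incompC => _; apply: antia.
  + by move: wR wR'; rewrite !memR => /and3P[_ _ wP] /and3P[_ _ wP']; apply: anti.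
- move=> w; rewrite inE => /predU1P[->|].
    by exists c; apply: maps_split; case.
  rewrite memR => /and3P[_ _ wP].
  have [d dQ sd] := swap_antichain antiQ q0 c0 (map_f phi wP).
  have [d' _ td] := swap_antichain antiQ q1Q c1 dQ.
  by exists d'; apply: mapsM td (mapsM sd (phiP _ wP)).
Qed.

Lemma words_uniq n : uniq (words n).
Proof.
elim: n => // n IHn /=; rewrite cats0 cat_uniq !map_inj_uniq ?IHn //=; last first.
- by move=> u v [].
- by move=> u v [].
by rewrite andbT; apply/hasPn => _ /mapP[w _ ->]; apply/mapP => -[].
Qed.

Lemma swap_generation v : (forall a b, incomp a b -> H (swap a b)) -> H v.
Proof.
move=> Hswap; have [n vn] := maps_local v.
apply: (@swap_generation_on (words n)) => //; first exact: words_uniq.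
- move=> x; have [w [y [sw ->]]] := into_split n x.
  by exists w; rewrite mem_words sw eqxx; split=> //; exists y.
- move=> a b; rewrite !mem_words => /eqP sa /eqP sb /eqP ab.
  by rewrite incomp_size ?sa ?sb.
- by move=> w; rewrite mem_words => /eqP /vn.
Qed.

End Subgroup.

(** * Two generators *)

Lemma incomp_prefix a b c d : prefix a c -> prefix b d -> incomp a b -> incomp c d.
Proof. by move=> /prefixP[r ->] /prefixP[s ->]; apply: incomp_cat. Qed.

Section Subgroup.

Variable H : set thompson.
Hypothesis Hsub : is_subgroup H.

Let H1 : H 1. Proof. by case: Hsub. Qed.
Let HM u v : H u -> H v -> H (u * v). Proof. by case: Hsub => _ + _; apply. Qed.
Let HV u : H u -> H u^-1. Proof. by case: Hsub => _ _; apply. Qed.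

(** Exchange the first three letters [p] of [a] with a word [g] of length 2 whose cone avoids those
    of [a] and [b]. This shortens [a], and either shortens [b] as well or leaves it alone. *)
Lemma shorten_step a b :
  (forall c d, size c = 3 -> size d = 2 -> H (swap c d)) ->
  incomp a b -> 2 < size a -> 1 < size b ->
  exists v c d, [/\ H v, maps v a c, maps v b d,
    (1 < size c) && (1 < size d) & size c + size d < size a + size b].
Proof.
move=> H32 ab sa sb.
have [g [sg ga gb]] : exists g : bits, [/\ size g = 2, g != take 2 a & g != take 2 b].
  (* Three candidates suffice against two forbidden prefixes. *)
  have /hasP[g] : has (fun g => (g != take 2 a) && (g != take 2 b))
      [:: [:: O; O]; [:: O; I]; [:: I; O]].
    move: (take 2 a) (take 2 b) => x y; apply: contraT => /hasPn h.
    move: (h [:: O; O] isT) (h [:: O; I] isT) (h [:: I; O] isT).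
    by rewrite !negb_and !negbK => /orP[] /eqP ? /orP[] /eqP ? /orP[] /eqP ?; congruence.
  rewrite !inE => /or3P[] /eqP -> /andP[ga gb];
  by [exists [:: O; O] | exists [:: O; I] | exists [:: I; O]].
have spref (w : bits) : 1 < size w -> g != take 2 w -> incomp g w.
  move=> sw gw; apply: (incomp_prefix (prefix_refl _) (prefix_take w 2)).
  by rewrite incomp_size ?size_takel ?sg.
pose p := take 3 a; have sp : size p = 3 by rewrite size_takel.
have gp : incomp g p.
  apply: spref; first by rewrite sp.
  by rewrite take_takel.
have pg : incomp p g by rewrite incompC.
have aE : p ++ drop 3 a = a by rewrite cat_take_drop.
have ma : maps (swap p g) a (g ++ drop 3 a).
  by rewrite -{1}aE; apply/maps_cat/swap_l.
have sa' : size (g ++ drop 3 a) < size a.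
  by rewrite -{2}aE !size_cat sg sp.
have [pb|npb] := boolP (prefix p b).
  have [s bE] := prefixP pb.
  exists (swap p g), (g ++ drop 3 a), (g ++ s); split=> //.
  - exact: H32.
  - by rewrite bE; apply/maps_cat/swap_l.
  - by rewrite !size_cat sg.
  - by apply: ltn_trans (_ : size a + size (g ++ s) < _);
      rewrite ?ltn_add2r ?ltn_add2l // bE !size_cat sg sp.
exists (swap p g), (g ++ drop 3 a), b; split=> //.
- exact: H32.
- apply: swap_out; last exact: spref.
  rewrite /incomp npb /=; apply/negP => bp.
  by move/andP: ab => [_ /negP]; apply; apply: prefix_trans bp (prefix_take _ _).
- by rewrite sb size_cat sg.
- by rewrite ltn_add2r.
Qed.

Lemma shorten_pair a b :
  (forall c d, size c = 3 -> size d = 2 -> H (swap c d)) ->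
  incomp a b -> 1 < size a -> 1 < size b ->
  exists v c d, [/\ H v, maps v a c, maps v b d, size c = 2 & size d = 2].
Proof.
move=> H32; have [n] := ubnP (size a + size b); elim: n a b => // n IHn a b.
rewrite ltnS => le ab sa sb.
have [sa3|sa2] := ltnP 2 (size a).
  have [u [c [d [Hu uc ud /andP[sc sd] lt]]]] := shorten_step H32 ab sa3 sb.
  have [|v [c' [d' [Hv vc vd sc' sd']]]] := IHn _ _ (leq_trans lt le) _ sc sd.
    exact: maps_incomp uc ud ab.
  exists (v * u), c', d'; split=> //.
  - exact: HM.
  - exact: mapsM vc uc.
  - exact: mapsM vd ud.
have [sb3|sb2] := ltnP 2 (size b).
  have ba : incomp b a by rewrite incompC.
  have [u [d [c [Hu ud uc /andP[sd sc] lt]]]] := shorten_step H32 ba sb3 sa.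
  rewrite addnC [size b + _]addnC in lt.
  have [|v [c' [d' [Hv vc vd sc' sd']]]] := IHn _ _ (leq_trans lt le) _ sc sd.
    exact: maps_incomp uc ud ab.
  exists (v * u), c', d'; split=> //.
  - exact: HM.
  - exact: mapsM vc uc.
  - exact: mapsM vd ud.
by exists 1, a, b; split=> //; apply/eqP; rewrite eqn_leq ?sa ?sa2 ?sb ?sb2.
Qed.

(** Incomparable words are nonempty, so their halves have words of length at least 2. *)
Lemma swap_lengthen a b :
  (forall a b, incomp a b -> 1 < size a -> 1 < size b -> H (swap a b)) ->
  incomp a b -> H (swap a b).
Proof.
move=> h ab; have [sa sb] : 0 < size a /\ 0 < size b.
  by case: a b ab => [|x a] [|y b].
rewrite swap_split //; apply: HM; apply: h; rewrite ?size_rcons // -!cats1;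
exact: incomp_cat.
Qed.

Lemma short_swap_generation v :
  (forall c d, size c = 3 -> size d = 2 -> H (swap c d)) ->
  (forall c d, size c = 2 -> size d = 2 -> H (swap c d)) -> H v.
Proof.
move=> H32 H22; apply: swap_generation => // a b; apply: swap_lengthen => {}a {}b.
move=> ab sa sb; have [u [c [d [Hu uc ud sc sd]]]] := shorten_pair H32 ab sa sb.
have cd := maps_incomp uc ud ab.
rewrite -(swap_conj cd (mapsV uc) (mapsV ud)) invgK.
exact: HM (HM (HV Hu) (H22 _ _ sc sd)) Hu.
Qed.

(** Conjugating the exchange by itself reverses its arguments. *)
Lemma swapC a b : swap a b = swap b a.
Proof.
have [ab|ab] := boolP (incomp a b); last by rewrite !swap_id // incompC.
by rewrite -(swap_conj ab (swap_l ab) (swap_r ab)) swapK mul1g swapV.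
Qed.

Lemma words_antichain n : antichain (words n).
Proof.
move=> a b; rewrite !mem_words => /eqP sa /eqP sb /eqP ab.
by rewrite incomp_size ?sa ?sb.
Qed.

(** On one level exchanges behave like transpositions: (a c) is the conjugate of (a b) by (b c). *)
Lemma swap_trans n a b c : a \in words n -> b \in words n -> c \in words n ->
  H (swap a b) -> H (swap b c) -> H (swap a c).
Proof.
move=> an bn cn Hab Hbc; have anti := @words_antichain n.
have [->|/eqP ca] := eqVneq c a; first by rewrite swap_id ?incompxx.
have [<-//|/eqP ba] := eqVneq b a.
have iab : incomp a b by apply: anti => // /esym.
rewrite -(@swap_conj (swap b c) a b) //.
- exact: HM (HM Hbc Hab) (HV Hbc).
- by apply: swap_out; apply: anti.
- exact: swap_move anti _ _.
Qed.

(** The exchanges of one level generate its full symmetric group. The tail is placed first; one more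
    exchange then brings the image of the head to its target without touching the words already
    placed. *)
Lemma level_transitive n s t :
  (forall a b, a \in words n -> b \in words n -> H (swap a b)) ->
  uniq s -> uniq t -> size s = size t ->
  {subset s <= words n} -> {subset t <= words n} ->
  exists v, [/\ H v,
    forall w, w \in words n -> exists2 u, u \in words n & maps v w u &
    forall i, i < size s -> maps v (nth [::] s i) (nth [::] t i)].
Proof.
move=> Hn; elim: s t => [|a s IHs] [|b t] //=.
  by move=> *; exists 1; split=> // w wn; exists w.
move=> /andP[as_ us] /andP[bt ut] [sz] ss st.
have [||v [Hv vn vs]] := IHs t us ut sz.
- by move=> w ws; apply: ss; rewrite inE ws orbT.
- by move=> w wt; apply: st; rewrite inE wt orbT.
have [a' a'n va] := vn a (ss _ (mem_head _ _)).
have bn : b \in words n by apply: st; rewrite mem_head.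
have anti := @words_antichain n.
exists (swap a' b * v); split.
- by apply: HM => //; apply: Hn.
- move=> w /vn[u un vu]; have [d dn sd] := swap_antichain anti a'n bn un.
  by exists d => //; apply: mapsM sd vu.
- case=> [|i] /= ilt; first by apply: mapsM va; apply: swap_move anti _ _.
  apply: mapsM (vs i ilt).
  have tn : nth [::] t i \in t by rewrite mem_nth -?sz.
  have tn' : nth [::] t i \in words n by apply: st; rewrite inE tn orbT.
  apply: swap_out.
    apply: maps_incomp va (vs i ilt) _; apply: anti.
    - by apply: ss; rewrite mem_head.
    - by apply: ss; rewrite inE mem_nth ?orbT.
    - by move=> e; rewrite e mem_nth in as_.
  by apply: anti => // e; rewrite e tn in bt.
Qed.

(** A cone of depth 2 is a pair of cones of depth 3, so the symmetric group of level three
    conjugates the one given mixed exchange to every exchange of depths 3 and 2. *)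
Lemma level_three_generation v :
  (forall a b, a \in words 3 -> b \in words 3 -> H (swap a b)) ->
  H (swap [:: O; O; I] [:: O; I]) -> H v.
Proof.
move=> H33 H0; apply: short_swap_generation.
  move=> p q sp sq; have [pq|/swap_id ->//] := boolP (incomp p q).
  pose s : seq bits := [:: [:: O; O; I]; [:: O; I; O]; [:: O; I; I]].
  pose t := [:: p; rcons q O; rcons q I].
  have neq c : p == rcons q c = false.
    by apply/eqP => pE; move/andP: pq => [_ /negP]; apply; rewrite pE prefix_rcons.
  have ut : uniq t.
    rewrite /t /= !inE !neq; apply/andP; split=> //.
    by rewrite andbT; apply/eqP => /rcons_inj[].
  have s3 : {subset s <= words 3} by move=> w; rewrite !inE => /or3P[] /eqP ->.
  have t3 : {subset t <= words 3}.
    by move=> w; rewrite mem_words !inE => /or3P[] /eqP ->; rewrite ?size_rcons ?sp ?sq.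
  have [u [Hu _ us]] := level_transitive H33 (isT : uniq s) ut (erefl _) s3 t3.
  rewrite -(@swap_conj u [:: O; O; I] [:: O; I]) //.
  - exact: HM (HM Hu H0) (HV Hu).
  - exact: (us 0%N).
  - by apply: maps_split => -[]; [apply: (us 2%N) | apply: (us 1%N)].
move=> p q sp sq; have [pq|/swap_id ->//] := boolP (incomp p q).
by rewrite swap_split //; apply: HM; apply: H33; rewrite mem_words size_rcons ?sp ?sq.
Qed.

End Subgroup.

(** The product of these adjacent transpositions is the 8-cycle sending each word of level three to
    the next. *)
Definition cycle_swaps : seq (bits * bits) := zip (words 3) (behead (words 3)).

Definition mixed_swaps : seq (bits * bits) :=
  [:: ([:: I; I; O], [:: I; I; I]); ([:: O; O; O], [:: O; O; I]);
      ([:: O; O; I], [:: O; I])].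

Lemma swaps_cat l l' : swaps (l ++ l') = swaps l * swaps l'.
Proof. exact: big_cat. Qed.

Lemma swaps1 p : swaps [:: p] = swap p.1 p.2.
Proof. exact: big_seq1. Qed.

(* The second generator is the product of a transposition and of a disjoint
   3-cycle of cones: its powers of exponents 3 and 4 recover these two factors. *)
Lemma thompson_two_generated : two_generated thompson.
Proof.
exists (swaps cycle_swaps), (swaps mixed_swaps); apply/seteqP; split=> // v _.
move=> H [Hsub /= Hgen].
have Hc : H (swaps cycle_swaps) by apply: Hgen; left.
have Hy : H (swaps mixed_swaps) by apply: Hgen; right.
have [H1 HM HV] := Hsub.
pose a0 : bits := [:: I; I; O]; pose a1 : bits := [:: I; I; I].
pose nx := next (words 3).
have Ha : H (swap a0 a1).
  rewrite -[swap _ _](swaps1 (a0, a1)).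
  (* Depth 6 is enough to follow every word through three, and below four, copies of the
     generator. *)
  rewrite -(@swaps_eq 6 (mixed_swaps ++ mixed_swaps ++ mixed_swaps)); last by vm_compute.
  by rewrite !swaps_cat; do 2!apply: (HM _ _) => //.
have Hr : H (swaps (behead mixed_swaps)).
  rewrite -(@swaps_eq 6 (mixed_swaps ++ mixed_swaps ++ mixed_swaps ++ mixed_swaps));
    last by vm_compute.
  by rewrite !swaps_cat; do 3!apply: (HM _ _) => //.
have mapsc w : w \in words 3 -> maps (swaps cycle_swaps) w (nx w).
  have /allP h : all (fun w => swapsw cycle_swaps w == Some (nx w)) (words 3).
    by vm_compute.
  by move=> /h /eqP; apply: maps_swaps.
have nxn k w : w \in words 3 -> iter k nx w \in words 3.
  by move=> w3; elim: k => //= k; rewrite mem_next.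
(* As [a1] is [nx a0], conjugating by powers of the 8-cycle yields the exchange of every cyclically
   consecutive pair. *)
have Hk k : incomp (iter k nx a0) (iter k nx a1) /\
            H (swap (iter k nx a0) (iter k nx a1)).
  elim: k => // k [ik IHk].
  have mk w : w \in words 3 -> maps (swaps cycle_swaps) (iter k nx w) (iter k.+1 nx w).
    by move=> w3; apply/mapsc/nxn.
  split; first by apply: maps_incomp (mk a0 _) (mk a1 _) ik.
  by rewrite -(swap_conj ik (mk a0 _) (mk a1 _)) //;
    apply: (HM _ _ (HM _ _ Hc IHk) (HV _ Hc)).
have H0 k : H (swap a0 (iter k nx a0)).
  elim: k => [|k IHk]; first by rewrite swap_id ?incompxx.
  apply: (@swap_trans H Hsub 3 _ (iter k nx a0)) => //; try exact: nxn.
  by rewrite iterSr; have [_] := Hk k.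
have Hall w : w \in words 3 -> H (swap a0 w).
  (* The word [a0] has index 6 in a cycle of length 8, hence the shift by 2. *)
  have /allP h : all (fun w => w == iter (index w (words 3) + 2) nx a0) (words 3).
    by vm_compute.
  by move=> /h /eqP ->; apply: H0.
have H33 a b : a \in words 3 -> b \in words 3 -> H (swap a b).
  move=> an bn; apply: (@swap_trans H Hsub 3 _ a0) => //; last exact: Hall.
  by rewrite swapC; apply: Hall.
apply: (level_three_generation Hsub _ H33).
(* The 3-cycle is an exchange of level three times the mixed exchange; the former cancels. *)
have -> : swap [:: O; O; I] [:: O; I] =
    swap [:: O; O; O] [:: O; O; I] * swaps (behead mixed_swaps).
  by rewrite /swaps /= !big_cons big_nil /= mulg1 mulgA swapK mul1g.
by apply: (HM _ _) => //; apply: H33.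
Qed.

(** * Simplicity *)

Lemma conj_normal (N : set thompson) u v :
  is_normal_subgroup N -> N v -> N (u * v * u^-1).
Proof. by case=> _ /(_ _ u^-1) /[apply]; rewrite /conjg invgK mulgA. Qed.

(** A cone around a moved point goes from [a] to some [b] different from [a]. If one extends the
    other by [d], appending a word [c] incomparable with [d] to both separates them. *)
Lemma moved_cone (g : thompson) : g <> 1 ->
  exists a b, incomp a b /\ maps g a b.
Proof.
move=> g1; have [x gx] : exists x, ev g x <> x.
  by apply: contrapT => /forallNP h; apply: g1; apply: ev_inj => x; apply: contrapT.
have [n gn] := maps_local g; have [a [y [/gn[b gab] xE]]] := into_split n x.
have [|ab] := boolP (incomp a b); last first.
  have other (d : bits) : d <> [::] -> exists c : bits, incomp c d.
    by case: d => // z d _; exists [:: ~~ z]; rewrite /incomp /=; case: z.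
  have ne : a <> b by move=> e; apply: gx; rewrite xE gab e.
  move: ab; rewrite negb_and !negbK => /orP[] /prefixP[d dE].
    have [|c cd] := other d; first by move=> d0; apply: ne; rewrite dE d0 cats0.
    exists (a ++ c), (b ++ c); split; last exact: maps_cat.
    rewrite dE -catA incomp_cat2l.
    exact: incomp_prefix (prefix_refl c) (prefix_prefix d c) cd.
  have [|c cd] := other d; first by move=> d0; apply: ne; rewrite dE d0 cats0.
  exists (a ++ c), (b ++ c); split; last exact: maps_cat.
  rewrite dE -catA incomp_cat2l incompC.
  exact: incomp_prefix (prefix_refl c) (prefix_prefix d c) cd.
by exists a, b.
Qed.

Lemma setT_subgroup (G : groupType) : is_subgroup (setT : set G).
Proof. by split. Qed.

(** The commutator of [s] and [g] is [s * t], with [t] the copy of [s] inside the cone of [b].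
    Conjugating by [h], which moves only points in the cone of [a], turns it into [s' * t]; dividing
    the two removes [t] and leaves [s * s'], an exchange of two halves. *)
Lemma normal_swap N g : is_normal_subgroup N -> N g -> g <> 1 ->
  exists a b, [/\ incomp a b, 1 < size a, 1 < size b & N (swap a b)].
Proof.
move=> nN Ng g1; have [[N1 NM NV] _] := nN.
have [a [b [ab gab]]] := moved_cone g1.
have sa : 0 < size a by case: a b ab {gab} => [|x a] [|y b].
exists (rcons a O), (rcons a I); split; rewrite ?size_rcons //.
  by rewrite -!cats1 incomp_cat2l.
have inc c d : incomp (a ++ c) (a ++ d) = incomp c d by apply: incomp_cat2l.
have incb c d : incomp (b ++ c) (b ++ d) = incomp c d by apply: incomp_cat2l.
have iab c d : incomp (a ++ c) (b ++ d) by apply: incomp_cat.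
pose s := swap (a ++ [:: O; O]) (a ++ [:: I; O]).
pose s' := swap (a ++ [:: O; I]) (a ++ [:: I; I]).
pose t := swap (b ++ [:: O; O]) (b ++ [:: I; O]).
have Nst : N (s * t).
  have <- : g * s * g^-1 = t by apply: swap_conj; rewrite ?inc //; apply: maps_cat.
  rewrite !mulgA; apply: (NM _ _ _ (NV _ Ng)).
  by rewrite -{2}[s]swapV; apply: conj_normal.
pose h := swap (a ++ [:: O; O]) (a ++ [:: O; I]) * swap (a ++ [:: I; O]) (a ++ [:: I; I]).
have hs : h * s * h^-1 = s'.
  apply: swap_conj; rewrite ?inc //.
    by apply: mapsM (swap_l _) (swap_out _ _); rewrite ?inc.
  by apply: mapsM (swap_out _ _) (swap_l _); rewrite ?inc.
have ht : h * t * h^-1 = t.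
  by apply: swap_conj; rewrite ?incb //; apply: mapsM (swap_out _ _) (swap_out _ _).
have Ns't : N (s' * t).
  rewrite -hs -{1}ht (_ : _ * _ = h * (s * t) * h^-1); first exact: conj_normal.
  by move: (h) => h'; rewrite !mulgA mulgVK.
rewrite swap_split; last by rewrite -!cats1 inc.
rewrite -!cats1 -!catA /= -/s -/s' (_ : s * s' = s * t * (s' * t)^-1).
  exact: (NM _ _ Nst (NV _ Ns't)).
by rewrite invgM mulgA mulgK /s' swapV.
Qed.

(** One exchange in [N] is conjugate to one of level two, hence all of level two lie in [N], and
    every exchange of longer words is conjugate to one of these. The conjugators may be arbitrary,
    so the shortening lemmas are used with the whole group. *)
Lemma thompson_simple : simple_group thompson.
Proof.
split; first by exists (swap [:: O] [:: I]) => /(congr1 (ev ^~ 0%N)).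
move=> N nN; have [[N1 NM NV] _] := nN.
have [[g [Ng g1]]|trivN] := pselect (exists g, N g /\ g <> 1); last first.
  left; apply/seteqP; split=> g /= => [Ng|->//].
  by apply: contrapT => g1; apply: trivN; exists g.
right; apply/seteqP; split=> // v _.
have T32 c d : size c = 3 -> size d = 2 -> (setT : set thompson) (swap c d) by [].
have [a [b [ab sa sb Nab]]] := normal_swap nN Ng g1.
have [u [c [d [_ uc ud sc sd]]]] := shorten_pair (setT_subgroup _) T32 ab sa sb.
have cd := maps_incomp uc ud ab.
have Ncd : N (swap c d) by rewrite -(swap_conj ab uc ud); apply: conj_normal.
have N22 p q : size p = 2 -> size q = 2 -> incomp p q -> N (swap p q).
  move=> sp sq pq.
  have us : uniq [:: c; d].
    by rewrite /= inE andbT; apply/eqP => e; rewrite e incompxx in cd.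
  have ut : uniq [:: p; q].
    by rewrite /= inE andbT; apply/eqP => e; rewrite e incompxx in pq.
  have two_words (x y : bits) : size x = 2 -> size y = 2 -> {subset [:: x; y] <= words 2}.
    by move=> sx sy w; rewrite mem_words !inE => /orP[] /eqP ->; apply/eqP.
  have T2 x y : x \in words 2 -> y \in words 2 -> (setT : set thompson) (swap x y) by [].
  have [v' [_ _ vs]] := level_transitive (setT_subgroup _) T2 us ut (erefl _)
    (two_words _ _ sc sd) (two_words _ _ sp sq).
  by rewrite -(swap_conj cd (vs 0%N isT) (vs 1%N isT)); apply: conj_normal.
apply: swap_generation => // p q; apply: swap_lengthen => // {}p {}q pq sp sq.
have [w [p' [q' [_ wp wq sp' sq']]]] := shorten_pair (setT_subgroup _) T32 pq sp sq.
have pq' := maps_incomp wp wq pq.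
rewrite -(swap_conj pq' (mapsV wp) (mapsV wq)).
by apply: conj_normal => //; apply: N22.
Qed.

(** * A surjective and non-injective unimodular word *)

(** This is the constant r: it permutes three cones cyclically, [I] to [OO] to [OI] to [I]. *)
Definition rotation : seq (bits * bits) :=
  [:: ([:: O; O], [:: O; I]); ([:: O; I], [:: I])].

Definition conjl (G : groupType) (g x : G) : G := g * x * g^-1.

Lemma conjlM (G : groupType) (g x y : G) : conjl g (x * y) = conjl g x * conjl g y.
Proof. by rewrite /conjl !mulgA mulgVK. Qed.

Lemma conjlM4 (G : groupType) (g a b c d : G) :
  conjl g (a * b * c * d) = conjl g a * conjl g b * conjl g c * conjl g d.
Proof. by rewrite !conjlM. Qed.

Lemma conjl_comp (G : groupType) (g h x : G) : conjl g (conjl h x) = conjl (g * h) x.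
Proof. by rewrite /conjl invgM !mulgA. Qed.

(** Membership in the subgroup K: the cone of [I] is fixed pointwise. *)
Definition left_supported (v : thompson) : Prop := maps v [:: I] [:: I].

Lemma left_supportedV v : left_supported v -> left_supported v^-1.
Proof. exact: mapsV. Qed.

(** If the target lies inside the cone of [OO] itself, a detour through [OI] makes both exchanges
    disjoint ones. *)
Lemma reach c : c <> [::] ->
  exists2 k, left_supported k & maps k [:: O; O] (O :: c).
Proof.
case: c => // -[] c _.
  by exists (swap [:: O; O] [:: O, I & c]); [apply: swap_out | apply: swap_l].
exists (swap [:: O; I] [:: O, O & c] * swap [:: O; O] [:: O; I]).
  by apply: mapsM (swap_out _ _) (swap_out _ _).
by apply: mapsM (swap_l _) (swap_l _).
Qed.

Lemma factor_fixing v : maps v [:: O; O] [:: O; O] ->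
  exists2 k, left_supported k & v = conjl (swaps rotation) k.
Proof.
move=> vO; pose r := swaps rotation.
have rI : maps r [:: I] [:: O; O] by apply: maps_swaps.
exists (r^-1 * v * r); first exact: mapsM (mapsM (mapsV rI) vO) rI.
by rewrite /conjl !mulgA mulgV mul1g mulgK.
Qed.

(** First [v], fixing the cone of [OO], brings the image of a small cone into the half [O]. Then [p]
    and [q] in K carry [OO] to a subcone and to its image, so [q^-1 * v^-1 * h * p] fixes [OO] and
    lies in r K r^-1. *)
Lemma factorization (h : thompson) : exists k1 k2 k3 k4,
  [/\ left_supported k1, left_supported k2, left_supported k3, left_supported k4
    & h = conjl (swaps rotation) k1 * k2 * conjl (swaps rotation) k3 * k4].
Proof.
have [n hn] := maps_local h.
have [u hu] := hn (nseq n O) (size_nseq _ _).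
have {hu}hu : maps h (O :: nseq n O) (rcons u O).
  have := maps_cat [:: O] hu; rewrite !cats1.
  by rewrite (_ : rcons _ _ = O :: nseq n O) // -cats1 -[[:: O]]/(nseq 1 O) -nseqD addn1.
have [v [w [vO vh]]] : exists v w, maps v [:: O; O] [:: O; O] /\
    maps (v^-1 * h) (O :: nseq n O) (O :: w).
  case: (rcons u O) hu (size_rcons u O) => // -[] w hu _.
    exists (swap [:: O; I] [:: I]), (I :: w); split; first exact: swap_out.
    rewrite swapV; apply: mapsM hu.
    exact: (maps_cat w (@swap_r [:: O; I] [:: I] isT)).
  by exists 1, w; rewrite invg1 mul1g.
(* The extra letter makes the argument of [reach] nonempty, also when [n] is 0 or [w] is empty. *)
have [|p p1 pO] := @reach (rcons (nseq n O) O); first by case: (nseq n O).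
have [|q q1 qO] := @reach (rcons w O); first by case: (w).
have [k1 k1l vE] := factor_fixing vO.
have [k3 k3l mE] : exists2 k, left_supported k & q^-1 * (v^-1 * h) * p = conjl (swaps rotation) k.
  apply: factor_fixing; apply: mapsM pO; apply: mapsM (mapsV qO) _.
  by rewrite -!rcons_cons -!cats1; apply: maps_cat.
exists k1, q, k3, p^-1; split=> //; first exact: left_supportedV.
by rewrite -vE -mE !mulgA mulgK mulgK mulgV mul1g.
Qed.

Lemma disjoint_commute u v : maps u [:: O] [:: O] -> left_supported v -> u * v = v * u.
Proof.
move=> uO vI; apply: ev_inj => x; rewrite !evM.
have intoE (z : nat) : z = into [:: odd z] z./2 by rewrite /= odd_double_half.
case ox: (odd x).
  have xE : x = into [:: I] x./2 by rewrite -ox -intoE.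
  rewrite {1}xE vI -xE; case oy: (odd (ev u x)).
    by rewrite (intoE (ev u x)) oy vI.
  have := intoE (ev u x); rewrite oy -uO => /(can_inj (evK u)) xE'.
  by move: ox; rewrite xE' /= add0n odd_double.
have xE : x = into [:: O] x./2 by rewrite -ox -intoE.
rewrite {2}xE uO -xE; case oy: (odd (ev v x)); last first.
  by rewrite (intoE (ev v x)) oy uO.
have := intoE (ev v x); rewrite oy -vI => /(can_inj (evK v)) xE'.
by move: ox; rewrite xE' /= add1n /= odd_double.
Qed.

(** The element [v^-1 * u] fixes the cone of [O] pointwise and so commutes with [k]: a conjugate of
    [k] depends only on where the cone of [O] goes. *)
Lemma conjl_place u v c k : left_supported k ->
  maps u [:: O] c -> maps v [:: O] c -> conjl u k = conjl v k.
Proof.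
move=> kl uc vc.
have E := disjoint_commute (mapsM (mapsV vc) uc) kl.
have -> : u = v * (v^-1 * u) by rewrite mulgA mulgV mul1g.
by rewrite -conjl_comp {2}/conjl E mulgK.
Qed.

Lemma conjl_swaps l m m' k : left_supported k ->
  (if swapsw (l ++ m) [:: O] is Some w then swapsw m' [:: O] == Some w else false) ->
  conjl (swaps l) (conjl (swaps m) k) = conjl (swaps m') k.
Proof.
move=> kl; case E: (swapsw _ _) => [w|] // /eqP E'.
rewrite conjl_comp -swaps_cat.
exact: conjl_place (maps_swaps E) (maps_swaps E').
Qed.

(** The exponent 0 fits the closing factor of each conjugate into the format of [word]. *)
Definition conj_word (G : groupType) (l : seq (G * int)) : seq (G * int) :=
  flatten [seq [:: p; (p.1^-1, 0%R)] | p <- l].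

Lemma subst_conj_word (G : groupType) (l : seq (G * int)) (g : G) :
  subst (word (conj_word l)) g = \prod_(p <- l) conjl p.1 (zexpg g p.2).
Proof.
rewrite subst_word; elim: l => [|p l IHl]; first by rewrite !big_nil.
by rewrite /= !big_cons IHl /= mulg1 mulgA.
Qed.

Lemma conj_word_sum (G : groupType) (l : seq (G * int)) :
  (\sum_(p <- conj_word l) p.2 = \sum_(p <- l) p.2)%R.
Proof.
elim: l => [|p l IHl]; first by rewrite !big_nil.
by rewrite /= !big_cons IHl /= GRing.add0r.
Qed.

Definition block (d : bits) : seq (bits * bits) := [:: ([:: O], I :: d)].

Definition shifts (ds : seq bits) : seq (bits * bits) :=
  [seq (I :: d, [:: O, O & d]) | d <- ds].

Definition alternate (G : groupType) (a1 b1 a2 b2 a3 b3 a4 : G) : seq (G * int) :=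
  [:: (a1, 1%R); (b1, (-1)%R); (a2, 1%R); (b2, (-1)%R);
      (a3, 1%R); (b3, (-1)%R); (a4, 1%R)].

Lemma prod_alternate (G : groupType) (a1 b1 a2 b2 a3 b3 a4 x : G) :
  \prod_(p <- alternate a1 b1 a2 b2 a3 b3 a4) conjl p.1 (zexpg x p.2) =
  conjl a1 x * (conjl b1 x)^-1 * conjl a2 x * (conjl b2 x)^-1 * conjl a3 x *
  (conjl b3 x)^-1 * conjl a4 x.
Proof.
have conjlV (g : G) : conjl g x^-1 = (conjl g x)^-1.
  by rewrite /conjl !invgM invgK mulgA.
by rewrite !big_cons big_nil /= !conjlV mulg1 !mulgA.
Qed.

(** Each positive factor releases one block, to r(O) or to O, and parks the others inside [OO] or
    [I] respectively, the complements. The i-th inverse factor places blocks 1 to i as the next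
    positive factor does and the later blocks as the previous one does. *)
Definition alternating : seq (thompson * int) :=
  alternate (swaps (rotation ++ block [:: O; O]))
            (swaps (shifts [:: [:: O; I]; [:: I; O]; [:: I; I]]))
            (swaps (block [:: O; I]))
            (swaps (shifts [:: [:: O; O]; [:: O; I]]))
            (swaps (rotation ++ block [:: I; O]))
            (swaps (shifts [:: [:: I; I]]))
            (swaps (block [:: I; I])).

Definition the_word : freeprod thompson infcyclic := word (conj_word alternating).

Lemma the_word_unimodular : unimodular the_word.
Proof.
exists (conj_word alternating); split=> //; left.
by rewrite conj_word_sum /alternating !big_cons big_nil.
Qed.

Definition blocks (k1 k2 k3 k4 : thompson) : thompson :=
  conjl (swaps (block [:: O; O])) k1 * conjl (swaps (block [:: O; I])) k2 *
  conjl (swaps (block [:: I; O])) k3 * conjl (swaps (block [:: I; I])) k4.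

Lemma conjl_block l d k :
  conjl (swaps (l ++ block d)) (conjl (swaps (block d)) k) = conjl (swaps l) k.
Proof. by rewrite conjl_comp swaps_cat -mulgA !swaps1 swapK mulg1. Qed.

(* In the product of the seven conjugates each of the four blocks survives
   exactly once: the copies placed elsewhere cancel between neighbours, since
   the conjugates of [blocks k1 k2 k3 k4] keep the order of its factors. *)
Lemma subst_blocks k1 k2 k3 k4 :
  left_supported k1 -> left_supported k2 -> left_supported k3 -> left_supported k4 ->
  subst the_word (blocks k1 k2 k3 k4) =
    conjl (swaps rotation) k1 * k2 * conjl (swaps rotation) k3 * k4.
Proof.
move=> l1 l2 l3 l4; rewrite subst_conj_word prod_alternate.
pose E d k := conjl (swaps (block d)) k.
pose F d k := conjl (swaps (rotation ++ block d)) k.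
have conjl_block0 d k : conjl (swaps (block d)) (conjl (swaps (block d)) k) = k.
  by rewrite conjl_comp !swaps1 swapK /conjl mul1g invg1 mulg1.
have -> : conjl (swaps (rotation ++ block [:: O; O])) (blocks k1 k2 k3 k4) =
    conjl (swaps rotation) k1 * F [:: O; I] k2 * F [:: I; O] k3 * F [:: I; I] k4.
  by rewrite conjlM4 conjl_block; congr (_ * _ * _ * _); apply: conjl_swaps.
have -> : conjl (swaps (shifts [:: [:: O; I]; [:: I; O]; [:: I; I]])) (blocks k1 k2 k3 k4)
    = E [:: O; O] k1 * F [:: O; I] k2 * F [:: I; O] k3 * F [:: I; I] k4.
  by rewrite conjlM4; congr (_ * _ * _ * _); apply: conjl_swaps.
have -> : conjl (swaps (block [:: O; I])) (blocks k1 k2 k3 k4) =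
    E [:: O; O] k1 * k2 * E [:: I; O] k3 * E [:: I; I] k4.
  by rewrite conjlM4 conjl_block0; congr (_ * _ * _ * _); apply: conjl_swaps.
have -> : conjl (swaps (shifts [:: [:: O; O]; [:: O; I]])) (blocks k1 k2 k3 k4)
    = F [:: O; O] k1 * F [:: O; I] k2 * E [:: I; O] k3 * E [:: I; I] k4.
  by rewrite conjlM4; congr (_ * _ * _ * _); apply: conjl_swaps.
have -> : conjl (swaps (rotation ++ block [:: I; O])) (blocks k1 k2 k3 k4) =
    F [:: O; O] k1 * F [:: O; I] k2 * conjl (swaps rotation) k3 * F [:: I; I] k4.
  by rewrite conjlM4 conjl_block; congr (_ * _ * _ * _); apply: conjl_swaps.
have -> : conjl (swaps (shifts [:: [:: I; I]])) (blocks k1 k2 k3 k4)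
    = E [:: O; O] k1 * E [:: O; I] k2 * E [:: I; O] k3 * F [:: I; I] k4.
  by rewrite conjlM4; congr (_ * _ * _ * _); apply: conjl_swaps.
have -> : conjl (swaps (block [:: I; I])) (blocks k1 k2 k3 k4) =
    E [:: O; O] k1 * E [:: O; I] k2 * E [:: I; O] k3 * k4.
  by rewrite conjlM4 conjl_block0; congr (_ * _ * _ * _); apply: conjl_swaps.
(* With the conjugates made opaque, only free cancellation remains. *)
move: (conjl _ k1) (conjl _ k3) (E) (F) => A1 A3 E' F'.
by rewrite !invgM !mulgA !(mulgK, mulgVK).
Qed.

Lemma the_word_surjective h : exists g, subst the_word g = h.
Proof.
have [k1 [k2 [k3 [k4 [l1 l2 l3 l4 ->]]]]] := factorization h.
by exists (blocks k1 k2 k3 k4); apply: subst_blocks.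
Qed.

Lemma the_word_not_injective : ~ injective (subst the_word).
Proof.
pose k := swap [:: O; O] [:: O; I]; have lk : left_supported k by apply: swap_out.
have l1 : left_supported 1 by apply: maps1.
(* Since [k] is an involution, both arguments have the value 1. *)
move=> /(_ (blocks 1 k 1 k) (blocks 1 1 1 1)); rewrite !subst_blocks //.
rewrite /conjl !mulg1 mulgV !mulg1 mul1g swapK => /(_ erefl).
(* 5 = into [:: I; O; I; O] 0 lies in a cone moved by the second block. *)
move=> /(congr1 (ev ^~ 5%N)).
by rewrite /blocks /conjl /block !swaps1; vm_compute.
Qed.

Theorem theorem1 :
  exists (G : groupType) (u : freeprod G infcyclic),
    [/\ simple_group G, two_generated G, unimodular u,
        forall h : G, exists g : G, subst u g = h
      & ~ injective (subst u)].
Proof.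
exists thompson, the_word; split.
- exact: thompson_simple.
- exact: thompson_two_generated.
- exact: the_word_unimodular.
- exact: the_word_surjective.
- exact: the_word_not_injective.
Qed.
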